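(* Let $I$ be a non-negative integer and let $n_1, n_2, \dots, n_{2I}, n_{2I+1}$ be integers. 1. The coloring system of equations of $R(n_1, n_2, \dots, n_{2I})$ and its determinant are, respectively, $$(b-a)\,p_{2I}^{e} = 0 \qquad\text{and}\qquad \det R(n_1, n_2, \dots, n_{2I}) = \left|p_{2I}^{e}\right| .$$ 2. The coloring system of equations of $R(n_1, n_2, \dots, n_{2I}, n_{2I+1})$ and its determinant are, respectively, $$(b-a)\,p_{2I+1}^{o} = 0 \qquad\text{and}\qquad \det R(n_1, n_2, \dots, n_{2I}, n_{2I+1}) = \left|p_{2I+1}^{o}\right| .$$ Here $b$ is the color of the top arc joining strands 1 and 2, and $a$ is the color of the top arc joining strands 3 and 4, in the standard diagram of the rational knot.
   Context: **Polynomials.** For $N\ge 0$, $IEO[N]$ is the set of strictly increasing finite sequences $(u_1,\dots,u_k)$ of elements of $\{1,\dots,N\}$ such that $u_j$ is even when $j$ is even and $u_j$ is odd when $j$ is odd, together with the empty sequence $\emptyset$ (so $IEO[0]=\{\emptyset\}$). For $u=(u_1,\dots,u_k)$ put $n_u = n_{u_1}n_{u_2}\cdots n_{u_k}$, and $n_\emptyset = 1$. Set $p_N=\sum_{u\in IEO[N]} n_u$. Let $p_N^{e}$ be the sum of $n_u$ over those $u\in IEO[N]$ of even length (including $\emptyset$), and let $p_N^{o}=p_N-p_N^{e}$ (the sum over those $u$ of odd length). **Rational knots.** $R(n_1,\dots,n_N)$ is the knot or link with the following diagram (its standard diagram). Take four vertical strands, with positions numbered 1 to 4 from left to right, read from top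 to bottom. Join the tops of strands 1 and 2 by a cap and the tops of strands 3 and 4 by a cap. Then perform $N$ successive twists from top to bottom. The $i$-th twist consists of $|n_i|$ crossings, all of the sign of $n_i$, between positions 2 and 3 if $i$ is odd, and between positions 1 and 2 if $i$ is even. At the bottom, if $N$ is odd, join positions 1 and 2, and positions 3 and 4 (numerator closure). If $N$ is even, join positions 2 and 3, and positions 1 and 4 (denominator closure). For $N=0$ there are no twists and the denominator closure is used. **Signs of crossings.** Shade the regions of the diagram in checkerboard fashion, leaving the unbounded region unshaded. A crossing is positive if rotating its over-arc counterclockwise about the crossing sweeps out the shaded regions, and negative otherwise. Explicitly: in an odd-indexed twist (positions 2 and 3) a crossing is positive when the strand running from upper left to lower right is the over-strand. In an even-indexed twist (positions 1 and 2) a crossing is positive when the strand running from upper right to lower left is the over-strand. **Colorings and determinant.** A Fox coloring of a diagram assigns to each arc a color so that at each crossing twice the color of the over-arc equals the sum of the colors of the two under-arcs; equations are considered over the integers, or modulo any given integer. Regarding the arcs as unknowns, these crossing equations form a coloring system of equations (CSE) of the diagram, and its matrix of integer coefficients is the coloring matrix (made square by adding zero rows if there are fewer crossings than arcs). Any system whose matrix is obtained from the coloring matrix by elementary operations over the integers is also called a coloring system of equations of the knot. The elementary operations are integer row and column operations, and enlarging the matrix by a row and column which are zero except for a diagonal entry $1$, or the inverse of this. Trivial equations $0=0$ are dropped from the system. The determinant $\det K$ of the knot or link is the absolute value of any first minor of the (square) coloring matrix, i.e. of the determinant of the matrix obtained by deleting one row and one column (the empty determinant being $1$). *)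

(* Defs.v *)
From Stdlib Require Export Relation_Operators.
From mathcomp Require Export all_boot all_order all_algebra.
Set Implicit Arguments. Unset Strict Implicit. Unset Printing Implicit Defensive.
Import GRing.Theory Num.Theory.
Local Open Scope ring_scope.

(** * The polynomials p_N, p_N^e, p_N^o

The parameters n_1, n_2, ... are given by [n : nat -> int]; the value [n 0] is
never used. *)

(* [nth 0 u j] is the entry u_(j+1), which must have the parity of j + 1. *)
Definition ieo (N : nat) (u : seq nat) : bool :=
  [&& all (fun x => 0 < x <= N)%N u, sorted ltn u &
      all (fun j => odd (nth 0%N u j) == ~~ odd j) (iota 0%N (size u))].

(* A strictly increasing sequence in {1, ..., N} has length at most N, so
   bounding the length excludes nothing. *)
Definition IEO (N : nat) : {set N.-bseq 'I_N.+1} :=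
  [set u : N.-bseq 'I_N.+1 | ieo N (map val u)].

Definition nmon (n : nat -> int) (N : nat) (u : N.-bseq 'I_N.+1) : int :=
  \prod_(i <- u) n (val i).

Definition p (n : nat -> int) (N : nat) : int := \sum_(u in IEO N) nmon n u.

Definition pe (n : nat -> int) (N : nat) : int :=
  \sum_(u in IEO N | ~~ odd (size u)) nmon n u.

Definition po (n : nat -> int) (N : nat) : int := p n N - pe n N.

(** * Four-strand diagrams

A diagram is a word of crossings, read from top to bottom, together with a
closure; the tops of the strands are always joined by the two caps. Positions
are numbered 0, 1, 2, 3 from left to right. *)

(* Crossing between positions [cleft] and [cleft + 1]; [over_ul] says that the
   over-strand is the one running from upper left to lower right. *)
Record crossing := Crossing { cleft : nat; over_ul : bool }.

Inductive closure := Numerator | Denominator.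

Record diagram := Diagram { word : seq crossing; closing : closure }.

Definition over_top (c : crossing) : nat :=
  if over_ul c then cleft c else (cleft c).+1.
Definition over_bot (c : crossing) : nat :=
  if over_ul c then (cleft c).+1 else cleft c.
Definition under_top (c : crossing) : nat :=
  if over_ul c then (cleft c).+1 else cleft c.
Definition under_bot (c : crossing) : nat :=
  if over_ul c then cleft c else (cleft c).+1.

Section Diagram.
Variable D : diagram.

Definition ncross : nat := size (word D).
Definition cross (l : nat) : crossing := nth (Crossing 0%N true) (word D) l.

(* Crossing [l] lies between the levels [l] and [l + 1]; the segment (l, q) is
   the piece of strand at position q on level l. *)
Definition segment : finType := ('I_ncross.+1 * 'I_4)%type.
Definition seg (l q : nat) : segment := (inord l, inord q).

Definition passes (c : crossing) (q r : nat) : bool :=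
  if q \in [:: cleft c; (cleft c).+1]
  then (q == over_top c) && (r == over_bot c)
  else r == q.

Definition capped (q r : nat) : bool := (q, r) \in [:: (0, 1); (2, 3)]%N.

Definition closed_up (q r : nat) : bool :=
  match closing D with
  | Numerator => (q, r) \in [:: (0, 1); (2, 3)]%N
  | Denominator => (q, r) \in [:: (1, 2); (0, 3)]%N
  end.

(* The segments [s] and [t] are joined other than as the two under-ends of a
   crossing. *)
Definition joined (s t : segment) : bool :=
  let: (l, q) := s in let: (m, r) := t in
  [|| (m == l.+1 :> nat) && passes (cross l) q r,
      [&& l == 0%N :> nat, m == 0%N :> nat & capped q r] |
      [&& l == ncross :> nat, m == ncross :> nat & closed_up q r]].

Definition same_arc : rel segment :=
  connect (fun s t => joined s t || joined t s).

Definition arcs : {set {set segment}} :=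
  equivalence_partition same_arc [set: segment].

(* The equation 2 over - under - under = 0 of crossing [l]; contributions add
   up when some of these arcs coincide. *)
Definition crossing_coef (l : nat) (x : {set segment}) : int :=
  (seg l (over_top (cross l)) \in x)%:R *+ 2
  - (seg l (under_top (cross l)) \in x)%:R
  - (seg l.+1 (under_bot (cross l)) \in x)%:R.

(* A diagram never has more crossings than arcs: two arc ends meet at each
   crossing, and an arc has two ends or, if it is closed, none. So the rows
   [i < #|arcs|] include all crossings. *)
Definition coloring_matrix : 'M[int]_#|arcs| :=
  \matrix_(i, k) if (i < ncross)%N then crossing_coef i (enum_val k) else 0.

(* [arcs] is never empty, so this determines [d]. *)
Definition is_det (d : int) : Prop :=
  forall i j : 'I_#|arcs|, `|\det (row' i (col' j coloring_matrix))| = d.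

End Diagram.

(** * Systems of equations and elementary operations

A system [A x = 0] in an unknown vector x comes with two named colors, given as
linear forms in the unknowns: [colors *m x] is the column (b, a). This records
what b and a mean when column operations change the unknowns. *)

Record system :=
  System { nunk : nat; eqns : 'M[int]_nunk; colors : 'M[int]_(2, nunk) }.

Inductive elementary (n : nat) : 'M[int]_n -> Prop :=
| elem_add (i j : 'I_n) (c : int) :
    i != j -> elementary (1%:M + c *: delta_mx i j)
| elem_swap (i j : 'I_n) : elementary (tperm_mx i j)
| elem_opp (i : 'I_n) : elementary (diag_mx (\row_j (-1) ^+ (j == i))).

(* A column operation by E is the change of unknowns x = E y, hence it also acts
   on the color forms. The unknown added by an enlargement is forced to be 0 by
   its own equation, so its coefficients [w] in the color forms are arbitrary. *)
Inductive elem_op : system -> system -> Prop :=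
| op_row (n : nat) (A E : 'M[int]_n) (W : 'M[int]_(2, n)) :
    elementary E -> elem_op (System A W) (System (E *m A) W)
| op_col (n : nat) (A E : 'M[int]_n) (W : 'M[int]_(2, n)) :
    elementary E -> elem_op (System A W) (System (A *m E) (W *m E))
| op_enlarge (n : nat) (A : 'M[int]_n) (W : 'M[int]_(2, n)) (w : 'cV[int]_2) :
    elem_op (System A W)
            (System (block_mx A 0 0 (1%:M : 'M[int]_1)) (row_mx W w)).

(* b is the color of the cap on positions 0, 1 and a that of the cap on
   positions 2, 3. *)
Definition coloring_system (D : diagram) : system :=
  System (coloring_matrix D)
    (\matrix_(i < 2, k < #|arcs D|)
       (seg D 0%N (if i == 0 then 0%N else 2%N) \in enum_val k)%:R).

Definition is_cse (D : diagram) (S : system) : Prop :=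
  clos_refl_sym_trans system elem_op (coloring_system D) S.

(* The system (b - a) c = 0 in the unknowns b, a, made square by a trivial
   equation 0 = 0. *)
Definition bma_system (c : int) : system :=
  System (\matrix_(i < 2, j < 2)
            if i == 0 then (if j == 0 then c else - c) else 0)
         1%:M.

(** * Rational knots and links *)

(* A crossing of an odd twist is positive when the upper left to lower right
   strand is over, one of an even twist when the other strand is over. *)
Definition twist (n : nat -> int) (i : nat) : seq crossing :=
  nseq `|n i|%N (Crossing (if odd i then 1%N else 0%N) (odd i == (0 <= n i))).

Definition R (n : nat -> int) (N : nat) : diagram :=
  Diagram (flatten [seq twist n i | i <- iota 1%N N])
          (if odd N then Numerator else Denominator).

(* Main.v *)
Require Import Defs.
From mathcomp Require Import all_boot all_order all_algebra.
From mathcomp Require Import zify ring.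
Set Implicit Arguments. Unset Strict Implicit.
Unset Printing Implicit Defensive.
Import Order.TTheory GRing.Theory Num.Theory.
Local Open Scope ring_scope.

(** Let the two caps have colors b and a. Reading the diagram downwards, each
crossing determines the color of the strand that leaves it underneath, so every
segment gets a color of the form [t b + (1 - t) a] with an integer
[t = level_coord l q]. The alternating sum of the four values of [t] on a level
is 0 throughout. Hence the two arcs that close the diagram up impose, up to
sign, a single condition [(b - a) c = 0], where [c = bottom_gap] is the
difference of two neighbouring values of [t] at the bottom. A twist adds to
one of the two differences [t_1 - t_0], [t_1 - t_2] a multiple [n_i] of the
other (lemma [rational_coords]), which is the recursion satisfied by [po] and
[pe] (lemmas [poS] and [peS]). So [c] is [pe] or [po] according to the parity
of the number of twists.

It remains to turn this computation of the colorings into statements about the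
coloring matrix A. Let W express the cap colors b and a by the arcs, let P
express the arcs by b and a as above, and let B be the matrix of the system
[(b - a) c = 0]. The computation says that W and P induce mutually inverse maps
between the solutions of A and those of B; over the integers this means that
the rows of four matrices are integer combinations of the rows of A or of B.
Under these hypotheses A and B are presentations of the same group. Since both
are square, the two matrices [A 0; -W 1] and [1 -P; 0 B] have the same size and
the same row lattice, hence they differ by a product of elementary row
operations (lemmas [same_lattice] and [common_presentation]). The equivalence
of the systems follows (lemma [same_solutions]), and so does
[`|\det A| = `|\det B|] (lemma [same_abs_det]).

For the first minors the same principle is applied to other matrices. The
equations of the crossings, with suitable signs, add up to 0, so any one row i
of A is an integer combination of the others (lemma [redundant_row]). Replacing
it by the j-th basis vector gives a matrix whose determinant is, up to sign, the
minor at (i, j), and whose solutions are the colorings that vanish on the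
arc j. Correspondingly the zero row of B is replaced by the equation
[t b + (1 - t) a = 0], t being the value for the arc j, and the resulting
2 x 2 determinant is [c t + c (1 - t) = c].

All crossings occur among the rows of A because there are at least as many arcs
as crossings: the arcs are the components of a graph with [4 L + 4] vertices
and [3 L + 4] edges, where L is the number of crossings. *)

(** * Integer combinations of rows *)

(** The inclusion of row lattices. *)
Definition int_comb k m n (M : 'M[int]_(k, n)) (A : 'M[int]_(m, n)) : Prop :=
  exists X : 'M_(k, m), M = X *m A.

Lemma int_comb_trans k l m n (M : 'M[int]_(k, n)) (A : 'M_(l, n)) (B : 'M_(m, n)) :
  int_comb M A -> int_comb A B -> int_comb M B.
Proof. by move=> [X ->] [Y ->]; exists (X *m Y); rewrite mulmxA. Qed.

Lemma int_comb0 k m n (A : 'M[int]_(m, n)) : int_comb (0 : 'M_(k, n)) A.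
Proof. by exists 0; rewrite mul0mx. Qed.

Lemma int_combD k m n (M N : 'M[int]_(k, n)) (A : 'M_(m, n)) :
  int_comb M A -> int_comb N A -> int_comb (M + N) A.
Proof. by move=> [X ->] [Y ->]; exists (X + Y); rewrite mulmxDl. Qed.

Lemma int_combZ k m n a (M : 'M[int]_(k, n)) (A : 'M_(m, n)) :
  int_comb M A -> int_comb (a *: M) A.
Proof. by move=> [X ->]; exists (a *: X); rewrite scalemxAl. Qed.

Lemma int_combB k m n (M N : 'M[int]_(k, n)) (A : 'M_(m, n)) :
  int_comb M A -> int_comb N A -> int_comb (M - N) A.
Proof. by move=> [X ->] [Y ->]; exists (X - Y); rewrite mulmxBl. Qed.

Lemma int_comb_row m n (A : 'M[int]_(m, n)) i : int_comb (row i A) A.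
Proof. by exists (delta_mx 0 i); rewrite rowE. Qed.

Lemma int_comb_rows k m n (M : 'M[int]_(k, n)) (A : 'M_(m, n)) :
  (forall i, int_comb (row i M) A) -> int_comb M A.
Proof.
move=> /fin_all_exists[X eqX]; exists (\matrix_i X i).
by apply/row_matrixP=> i; rewrite eqX row_mul rowK.
Qed.

Lemma int_comb_mull m n k l (E : 'M[int]_(l, k)) (A : 'M_(m, n))
    (M : 'M_(k, n)) :
  int_comb M A -> int_comb (E *m M) A.
Proof. by case=> X ->; exists (E *m X); rewrite mulmxA. Qed.

Lemma int_comb_unit m n (E : 'M[int]_m) (A : 'M_(m, n)) k (M : 'M_(k, n)) :
  E \in unitmx -> int_comb M A -> int_comb M (E *m A).
Proof.
by move=> uE [X ->]; exists (X *m invmx E); rewrite -mulmxA mulKmx.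
Qed.

(** * Products of elementary matrices *)

Definition mulblockE := (mulmx1, mulmx0, mul0mx, mul1mx, addr0, add0r).

(** Swaps of rows are products of these two kinds of matrices, and only these two
have to be carried through the inductions. *)
Inductive elemprod n : 'M[int]_n -> Prop :=
| elemprod_one : elemprod 1%:M
| elemprod_add (E : 'M_n) (i j : 'I_n) (c : int) :
    i != j -> elemprod E -> elemprod (E *m (1%:M + c *: delta_mx i j))
| elemprod_opp (E : 'M_n) (i : 'I_n) :
    elemprod E -> elemprod (E *m diag_mx (\row_j (-1) ^+ (j == i))).

Lemma elemprodM n (E F : 'M[int]_n) :
  elemprod E -> elemprod F -> elemprod (E *m F).
Proof.
move=> hE; elim=> [|{}F i j c ij _ IH|{}F i _ IH]; first by rewrite mulmx1.
- by rewrite mulmxA; apply: elemprod_add.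
- by rewrite mulmxA; apply: elemprod_opp.
Qed.

Lemma elemprod_add1 n (i j : 'I_n) c :
  i != j -> elemprod (1%:M + c *: delta_mx i j).
Proof. by move=> ij; rewrite -[_ + _]mul1mx; apply/elemprod_add/elemprod_one. Qed.

Lemma elemprod_opp1 n (i : 'I_n) :
  elemprod (diag_mx (\row_j (-1) ^+ (j == i))).
Proof. by rewrite -[diag_mx _]mul1mx; apply/elemprod_opp/elemprod_one. Qed.

Lemma elemprod_rinv n (E : 'M[int]_n) :
  elemprod E -> exists2 F, elemprod F & E *m F = 1%:M.
Proof.
elim=> [|{}E i j c ij _ [F hF EF]|{}E i _ [F hF EF]].
- by exists 1%:M; [apply: elemprod_one | rewrite mulmx1].
- exists ((1%:M + (- c) *: delta_mx i j) *m F).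
    by apply: elemprodM hF; apply: elemprod_add1.
  rewrite mulmxA -(mulmxA E) -[RHS]EF; congr (_ *m _); rewrite -[RHS]mulmx1.
  congr (_ *m _); rewrite mulmxDl mul1mx mulmxDr mulmx1 -scalemxAl -scalemxAr.
  by rewrite mul_delta_mx_0 1?eq_sym // !scaler0 addr0 scaleNr subrK.
- exists (diag_mx (\row_j (-1) ^+ (j == i)) *m F).
    by apply: elemprodM hF; apply: elemprod_opp1.
  rewrite mulmxA -(mulmxA E) -[RHS]EF; congr (_ *m _); rewrite -[RHS]mulmx1.
  congr (_ *m _); rewrite mulmx_diag -diag_const_mx; congr diag_mx.
  by apply/rowP=> j; rewrite !mxE -expr2 sqrr_sign.
Qed.

Lemma elemprod_unit n (E : 'M[int]_n) : elemprod E -> E \in unitmx.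
Proof. by case/elemprod_rinv=> F _ /mulmx1_unit[]. Qed.

Lemma elemprod_inv n (E : 'M[int]_n) : elemprod E -> elemprod (invmx E).
Proof.
move=> hE; have [F hF EF] := elemprod_rinv hE.
by rewrite -[invmx E]mulmx1 -EF mulKmx ?elemprod_unit.
Qed.

Lemma elemprod_det n (E : 'M[int]_n) : elemprod E -> `|\det E| = 1.
Proof.
move/elemprod_unit; rewrite unitmxE => /orP[] /eqP ->; first exact: normr1.
by rewrite normrN1.
Qed.

Lemma elemprod_lift n (E : 'M[int]_n) :
  elemprod E -> elemprod (block_mx (1%:M : 'M_1) 0 0 E).
Proof.
elim=> [|{}E i j c ij _ IH|{}E i _ IH].
- by rewrite -scalar_mx_block; apply: elemprod_one.
- have -> : block_mx (1%:M : 'M_1) 0 0 (E *m (1%:M + c *: delta_mx i j))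
     = block_mx (1%:M : 'M_1) 0 0 E *m
       (1%:M + c *: delta_mx (rshift 1 i) (rshift 1 j)).
    have -> : delta_mx (rshift 1 i) (rshift 1 j) =
        block_mx (0 : 'M[int]_1) 0 0 (delta_mx i j).
      by rewrite delta_mx_dshift delta_mx_rshift block_mxEv row_mx0.
    rewrite scale_block_mx scalar_mx_block add_block_mx mulmx_block.
    by rewrite !(scaler0, addr0, mulmx0, mul0mx, mulmx1, add0r).
  by apply: elemprod_add IH; rewrite (inj_eq (@rshift_inj _ _)).
- have -> : block_mx (1%:M : 'M_1) 0 0
        (E *m diag_mx (\row_j (-1) ^+ (j == i))) =
      block_mx (1%:M : 'M_1) 0 0 E *m
        diag_mx (\row_j (-1) ^+ (j == rshift 1 i)) :> 'M[int]__.
    have -> : \row_j (-1) ^+ (j == rshift 1 i) =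
        row_mx (const_mx 1 : 'rV[int]_1) (\row_j (-1) ^+ (j == i)).
      apply/rowP=> j; rewrite !mxE.
      by case: split_ordP => k ->; rewrite mxE eq_shift.
    rewrite diag_mx_row mulmx_block diag_const_mx.
    by rewrite !(addr0, mulmx0, mul0mx, mulmx1, add0r).
  exact: elemprod_opp.
Qed.

(** The summands [x_j delta_(0,j)] multiply to zero pairwise, so adding them up is
the same as multiplying the elementary matrices [1 + x_j delta_(0,j)]. *)
Lemma elemprod_shear n (x : 'rV[int]_n) :
  elemprod (block_mx (1%:M : 'M_1) x 0 1%:M).
Proof.
pose N (s : seq 'I_n) : 'M[int]_(1 + n) :=
  \sum_(j <- s) x 0 j *: delta_mx (lshift n (0 : 'I_1)) (rshift 1 j).
have N_col0 s i : N s i (lshift n 0) = 0.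
  rewrite summxE big1 // => j _; rewrite !mxE eq_shift /=.
  by rewrite andbF mulr0.
suff all_s s : elemprod (1%:M + N s).
  have -> : block_mx (1%:M : 'M_1) x 0 1%:M = 1%:M + N (enum 'I_n);
    last exact: all_s.
  have -> : N (enum 'I_n) = block_mx (0 : 'M_1) x 0 0.
    rewrite /N big_enum /= -[RHS]/(block_mx (0 : 'M_1) x 0 0).
    under eq_bigr => j _.
      have -> : delta_mx (lshift n 0) (rshift 1 j) =
          block_mx (0 : 'M[int]_1) (delta_mx 0 j) 0 0.
        by rewrite delta_mx_ushift delta_mx_rshift block_mxEv row_mx0.
      rewrite scale_block_mx !scaler0; over.
    rewrite [in RHS](row_sum_delta x).
    elim/big_rec2: _ => [|j A B _ ->]; first by rewrite block_mx0.
    by rewrite add_block_mx !addr0.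
  by rewrite scalar_mx_block add_block_mx !addr0 add0r.
elim: s => [|j s IH].
  by rewrite /N big_nil addr0; apply: elemprod_one.
have -> : 1%:M + N (j :: s) =
    (1%:M + N s) *m (1%:M + x 0 j *: delta_mx (lshift n 0) (rshift 1 j)).
  have zero : N s *m delta_mx (lshift n 0) (rshift 1 j) = 0.
    apply/matrixP=> i k; rewrite !mxE big1 // => l _; rewrite !mxE.
    have [->|] := eqVneq l (lshift n 0); last by rewrite mulr0.
    by rewrite N_col0 mul0r.
  rewrite mulmxDr mulmx1 mulmxDl mul1mx -scalemxAr zero scaler0 addr0.
  by rewrite {1}/N big_cons -/(N s) -addrA [X in _ + X]addrC.
by apply: elemprod_add IH; rewrite eq_shift.
Qed.

Lemma add_rowE m k (M : 'M[int]_(m, k)) i j c a b :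
  ((1%:M + c *: delta_mx i j) *m M) a b = M a b + (c * M j b) *+ (a == i).
Proof.
rewrite mulmxDl mul1mx -scalemxAl !mxE (bigD1 j) //= big1 => [|l /negPf lj].
  by rewrite !mxE eqxx andbT addr0; case: (a == i); rewrite ?mul1r ?mul0r ?mulr0.
by rewrite !mxE lj andbF mul0r.
Qed.

Lemma opp_rowE m k (M : 'M[int]_(m, k)) i a b :
  (diag_mx (\row_j (-1) ^+ (j == i)) *m M) a b = (-1) ^+ (a == i) * M a b.
Proof. by rewrite mul_diag_mx !mxE. Qed.

(** The Euclidean algorithm on the first column: as long as some row
i other than row 0 has a nonzero entry, the larger of this entry and that of
row 0 is reduced modulo the smaller one. The sign of the remaining entry is normalized in order to make it unique, which
[same_lattice] relies on. *)
Lemma pivot m k (M : 'M[int]_(m.+1, k.+1)) :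
  exists2 E, elemprod E &
    0 <= (E *m M) 0 0 /\ forall i, i != 0 -> (E *m M) i 0 = 0.
Proof.
(* The last summand lets the move of a nonzero entry into row 0 count as progress. *)
pose mu (M : 'M[int]_(m.+1, k.+1)) : nat :=
  (2 * (\sum_i absz (M i 0%R)) + (M 0%R 0%R == 0%R))%N.
have [d] := ubnP (mu M); elim: d M => // d IH M leMd.
have step F : elemprod F -> (mu (F *m M) < mu M)%N -> exists2 E, elemprod E &
    0 <= (E *m M) 0 0 /\ forall i, i != 0 -> (E *m M) i 0 = 0.
  move=> hF lt_mu; have [|E hE prop] := IH (F *m M); first lia.
  by exists (E *m F); [apply: elemprodM | rewrite -mulmxA].
have [i /andP[i0 Mi]|all0] := pickP (fun i => (i != 0) && (M i 0 != 0));
    last first.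
  have {}all0 i : i != 0 -> M i 0 = 0.
    by move=> i0; move: (all0 i); rewrite i0 /= => /negbFE/eqP.
  have [M0|M0] := leP 0 (M 0 0).
    by exists 1%:M; [apply: elemprod_one | rewrite mul1mx].
  exists (diag_mx (\row_j (-1) ^+ (j == 0))); first exact: elemprod_opp1.
  rewrite opp_rowE eqxx expr1 mulN1r oppr_ge0 ltW //; split=> // i i0.
  by rewrite opp_rowE all0 // mulr0.
(* lowering one entry of the first column *)
have reduce a b : a != b -> M b 0 != 0 -> (absz (M b 0%R) <= absz (M a 0%R))%N ->
    exists2 F, elemprod F &
      (\sum_i absz ((F *m M)%R i 0%R) < \sum_i absz (M i 0%R))%N.
  move=> ab Mb le_ba; pose q := (M a 0%R %/ M b 0%R)%Z.
  exists (1%:M + (- q) *: delta_mx a b); first exact: elemprod_add1.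
  rewrite (bigD1 a) //= [X in (_ < X)%N](bigD1 a) //=.
  rewrite (eq_bigr (fun i => absz (M i 0))) => [|j /negPf ja]; last first.
    by rewrite add_rowE ja addr0.
  rewrite ltn_add2r add_rowE eqxx mulr1n mulNr.
  have := divz_eq (M a 0) (M b 0); rewrite -/q.
  have := modz_ge0 (M a 0) Mb; have := ltz_mod (M a 0) Mb.
  lia.
have arith (s1 s2 : nat) (b1 b2 : bool) : (s1 < s2)%N ->
    (2 * s1 + b1 < 2 * s2 + b2)%N by case: b1; case: b2; lia.
have [M00|M00] := eqVneq (M 0 0) 0; last first.
  have [leiM|ltiM] := leqP (absz (M i 0)) (absz (M 0 0)).
    have i0' : 0 != i by rewrite eq_sym.
    have [F hF lt] := reduce 0 i i0' Mi leiM.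
    by apply: (step F hF); exact: arith lt.
  have [F hF lt] := reduce i 0 i0 M00 (ltnW ltiM).
  by apply: (step F hF); exact: arith lt.
(* swapping the zero entry with a nonzero one *)
pose F : 'M[int]_m.+1 :=
  (1%:M + (-1) *: delta_mx i 0) *m (1%:M + 1 *: delta_mx 0 i).
have FE a : (F *m M) a 0 = if a == 0 then M i 0 else if a == i then 0 else M a 0.
  rewrite /F -mulmxA !add_rowE; have [->|a0] := eqVneq a 0.
    by rewrite eq_sym (negPf i0) addr0 M00 add0r mul1r.
  have [->|_] := eqVneq a i; last by rewrite !addr0.
  by rewrite !eqxx M00 !mulr1n mulr0n; lia.
apply: (step F).
  by apply: elemprodM; apply: elemprod_add1; rewrite // eq_sym.
rewrite /mu FE eqxx M00 eqxx (negPf Mi) addn0 addn1 ltnS leq_mul2l /=.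
rewrite (bigD1 0) //= (bigD1 i) //= [X in (_ <= X)%N](bigD1 0) //=.
rewrite [X in (_ <= _ + X)%N](bigD1 i) //= !FE eqxx (negPf i0) eqxx M00.
rewrite absz0 !add0n leq_add2l; apply: leq_sum => j /andP[j0 ji].
by rewrite FE (negPf j0) (negPf ji).
Qed.

(** * Matrices with the same row lattice *)

Lemma pivot_block m k (M : 'M[int]_(1 + m, 1 + k)) :
  exists E (g : int) r M', [/\ elemprod E, 0 <= g &
    E *m M = block_mx (g%:M : 'M_1) r (0 : 'M_(m, 1)) M'].
Proof.
have [E hE [g0 col0]] := pivot M.
exists E; move: (E *m M : 'M_(1 + m, 1 + k)) g0 col0 => N g0 col0.
exists (N 0 0), (ursubmx N), (drsubmx N); split=> //.
rewrite -[LHS]submxK; congr block_mx.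
  apply/matrixP=> i j; rewrite !ord1 !mxE eqxx mulr1n; congr (N _ _);
    exact: val_inj.
apply/matrixP=> i j; rewrite ord1 !mxE -[RHS](col0 (rshift 1 i)) //.
by congr (N _ _); apply: val_inj.
Qed.

Lemma int_comb_block m k (g1 g2 : int) r1 r2 (M1 M2 : 'M[int]_(m, k)) :
  int_comb (block_mx (g2%:M : 'M_1) r2 0 M2) (block_mx (g1%:M : 'M_1) r1 0 M1) ->
  exists x y z T, [/\ g2 = x * g1, r2 = x *: r1 + y *m M1, z *m g1%:M = 0 &
     M2 = z *m r1 + T *m M1].
Proof.
case=> X; rewrite -[X]submxK mulmx_block !mulmx0 !addr0.
case/eq_block_mx; rewrite [ulsubmx X]mx11_scalar -scalar_mxM.
move=> /(congr1 (fun A : 'M_1 => A 0 0)); rewrite !mxE !eqxx !mulr1n.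
move=> -> r0 z0 M0.
exists (ulsubmx X 0 0), (ursubmx X), (dlsubmx X), (drsubmx X).
by split; rewrite -?z0 // ?mxE // r0 mul_scalar_mx.
Qed.

(** Induction on the number of columns, after reducing the first column of both
matrices to a single entry. That entry generates the ideal of the first
coordinates of the lattice, so it is the same for both. If it is nonzero, the
vectors of the lattice with first coordinate 0 are spanned by the remaining
rows, whose lattices therefore agree too. *)
Lemma same_lattice m k (M1 M2 : 'M[int]_(m, k)) :
  int_comb M1 M2 -> int_comb M2 M1 -> exists2 E, elemprod E & M2 = E *m M1.
Proof.
elim: k m M1 M2 => [|k IHk] m M1 M2 h12 h21.
  by exists 1%:M; [apply: elemprod_one | rewrite !thinmx0].
case: m M1 M2 h12 h21 => [|m] M1 M2 h12 h21.
  by exists 1%:M; [apply: elemprod_one | rewrite [M1]flatmx0 [M2]flatmx0 mulmx0].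
change 'M[int]_(1 + m, 1 + k) in M1, M2.
have [E1 [g1 [r1 [N1 [hE1 g1_ge0 eq1]]]]] := pivot_block M1.
have [E2 [g2 [r2 [N2 [hE2 g2_ge0 eq2]]]]] := pivot_block M2.
have u1 := elemprod_unit hE1; have u2 := elemprod_unit hE2.
suff [E hE defE] : exists2 E, elemprod E & E2 *m M2 = E *m (E1 *m M1).
  exists (invmx E2 *m (E *m E1)).
    by apply: elemprodM; [apply: elemprod_inv | apply: elemprodM].
  by rewrite -!mulmxA -defE mulKmx.
have := int_comb_mull E2 (int_comb_unit u1 h21).
have := int_comb_mull E1 (int_comb_unit u2 h12).
rewrite {}eq1 {}eq2 => c12 c21.
have [x [y [z [T [gx r2E z0 N2E]]]]] := int_comb_block c21.
have [x' [y' [z' [T' [gx' r1E z'0 N1E]]]]] := int_comb_block c12.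
have eg : g2 = g1.
  apply/eqP; rewrite -(gez0_abs g1_ge0) -(gez0_abs g2_ge0) eqz_nat eqn_dvd.
  by apply/andP; split; [have := dvdz_mull x' (dvdzz g2); rewrite -gx'
                        |have := dvdz_mull x (dvdzz g1); rewrite -gx].
rewrite {}eg in gx z'0 c12 c21 *.
(* If the first column vanishes, no row is used up by it. *)
have [g0|g_neq0] := eqVneq g1 0.
  have block0 r (N : 'M[int]_(m, k)) :
      block_mx (g1%:M : 'M_1) r 0 N = row_mx (0 : 'M_(1 + m, 1)) (col_mx r N).
    by rewrite g0 block_mxEh raddf0 col_mx0.
  have comb0 r r' (N N' : 'M[int]_(m, k)) :
      int_comb (block_mx (g1%:M : 'M_1) r 0 N) (block_mx (g1%:M : 'M_1) r' 0 N') ->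
      int_comb (col_mx r N) (col_mx r' N').
    by case=> X; rewrite !block0 mul_mx_row => /eq_row_mx[_ ->]; exists X.
  have [E hE eqE] := IHk _ _ _ (comb0 _ _ _ _ c12) (comb0 _ _ _ _ c21).
  by exists E; rewrite // !block0 mul_mx_row mulmx0 eqE.
have x1 : x = 1 by apply: (mulIf g_neq0); rewrite -gx mul1r.
have zero (v : 'cV[int]_m) : v *m (g1%:M : 'M_1) = 0 -> v = 0.
  by move=> /eqP; rewrite mul_mx_scalar scalemx_eq0 (negPf g_neq0) => /eqP.
rewrite (zero _ z0) mul0mx add0r in N2E.
rewrite (zero _ z'0) mul0mx add0r in N1E.
have [E hE eqE] : exists2 E, elemprod E & N2 = E *m N1.
  by apply: IHk; [exists T' | exists T].
exists (block_mx (1%:M : 'M_1) y 0 E).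
  have -> : block_mx (1%:M : 'M_1) y 0 E =
      block_mx (1%:M : 'M_1) 0 0 E *m block_mx (1%:M : 'M_1) y 0 1%:M.
    by rewrite mulmx_block !mulblockE.
  by apply: elemprodM; [apply: elemprod_lift | apply: elemprod_shear].
rewrite mulmx_block !mulblockE -eqE.
by rewrite r2E x1 scale1r.
Qed.

(** * Matrices with the same solutions *)

(** The hypotheses say that [y = W x] and [x = P y] are mutually inverse bijections
between the solutions of [A x = 0] and [B y = 0], over any abelian group. Both
block matrices describe the pairs (x, y) of corresponding solutions: the right
one by [A x = 0] and [y = W x], the left one by [x = P y] and [B y = 0]. *)
Lemma common_presentation n m (A : 'M[int]_n) (B : 'M[int]_m)
    (W : 'M_(m, n)) (P : 'M_(n, m)) :
  int_comb (A *m P) B -> int_comb (B *m W) A ->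
  int_comb (1%:M - P *m W) A -> int_comb (1%:M - W *m P) B ->
  exists2 E, elemprod E &
    block_mx 1%:M (- P) 0 B = E *m block_mx A 0 (- W) 1%:M.
Proof.
move=> [T eqT] [S eqS] [Q eqQ] [U eqU]; apply: same_lattice.
- exists (block_mx A T (- W) U); rewrite mulmx_block !mulblockE.
  by rewrite mulNmx !mulmxN opprK -eqT -eqU addNr addrC subrK.
- exists (block_mx Q (- P) S B); rewrite mulmx_block !mulblockE.
  by rewrite mulNmx !mulmxN opprK -eqQ -eqS subrK subrr.
Qed.

Lemma same_abs_det n m (A : 'M[int]_n) (B : 'M[int]_m)
    (W : 'M_(m, n)) (P : 'M_(n, m)) :
  int_comb (A *m P) B -> int_comb (B *m W) A ->
  int_comb (1%:M - P *m W) A -> int_comb (1%:M - W *m P) B ->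
  `|\det A| = `|\det B|.
Proof.
move=> h1 h2 h3 h4; have [E hE] := common_presentation h1 h2 h3 h4.
move=> /(congr1 (fun M => `|\det M|)); rewrite det_ublock det_mulmx det_lblock.
by rewrite !det1 mul1r mulr1 normrM (elemprod_det hE) mul1r.
Qed.

(** * Equivalence of systems *)

Definition same_system := clos_refl_sym_trans system elem_op.

Lemma same_rows n (E A : 'M[int]_n) W :
  elemprod E -> same_system (System A W) (System (E *m A) W).
Proof.
move=> hE; elim: hE A => [|{}E i j c ij _ IH|{}E i _ IH] A.
- by rewrite mul1mx; apply: rst_refl.
- rewrite -mulmxA; apply: rst_trans (IH _).
  by apply: rst_step; apply: op_row; apply: elem_add.
- rewrite -mulmxA; apply: rst_trans (IH _).
  by apply: rst_step; apply: op_row; apply: elem_opp.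
Qed.

Lemma elemprod_of_unit n (F : 'M[int]_n) : F \in unitmx -> elemprod F.
Proof.
move=> uF; have [||E hE ->] := @same_lattice _ _ 1%:M F; last by rewrite mulmx1.
- by exists (invmx F); rewrite mulVmx.
- by exists F; rewrite mulmx1.
Qed.

Lemma same_columns n (A F : 'M[int]_n) W :
  F \in unitmx -> same_system (System A W) (System (A *m F) (W *m F)).
Proof.
move=> /elemprod_of_unit hF; elim: hF A W => [|{}F i j c ij _ IH|{}F i _ IH] A W.
- by rewrite !mulmx1; apply: rst_refl.
- rewrite !mulmxA; apply: rst_trans (IH _ _) _.
  by apply: rst_step; apply: op_col; apply: elem_add.
- rewrite !mulmxA; apply: rst_trans (IH _ _) _.
  by apply: rst_step; apply: op_col; apply: elem_opp.
Qed.

Lemma System_cast n n' (e : n = n') (A : 'M[int]_n) W :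
  System (castmx (e, e) A) (castmx (erefl, e) W) = System A W.
Proof. by case: n' / e; rewrite !castmx_id. Qed.

(** One unknown is added at a time; the casts are there because [n + m.+1] and
[n + 1 + m] are not convertible. *)
Lemma same_enlarged n m (A : 'M[int]_n) W (w : 'M_(2, m)) :
  same_system (System A W) (System (block_mx A 0 0 (1%:M : 'M_m)) (row_mx W w)).
Proof.
elim: m w n A W => [|m IH] w n A W.
  rewrite -(System_cast (addn0 n) (block_mx _ _ _ _)).
  suff [-> ->] : castmx (addn0 n, addn0 n) (block_mx A 0 0 (1%:M : 'M_0)) = A /\
      castmx (erefl, addn0 n) (row_mx W w) = W by apply: rst_refl.
  have shift (e : (n + 0)%N = n) (i : 'I_n) : cast_ord (esym e) i = lshift 0 i.
    exact: val_inj.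
  split; apply/matrixP=> i j; rewrite castmxE !shift ?block_mxEul //=.
  by rewrite cast_ord_id row_mxEl.
change 'M[int]_(2, 1 + m) in w.
apply: rst_trans (rst_step _ _ _ _ (op_enlarge A W (lsubmx w))) _.
apply: rst_trans (IH (rsubmx w) _ _ _) _.
rewrite -(System_cast (esym (addnA n 1 m)) (block_mx _ _ _ _)).
set S := System _ _; set S' := System _ _; suff -> : S = S' by apply: rst_refl.
rewrite /S /S' -[in RHS](hsubmxK w); congr System.
  have -> : block_mx A (0 : 'M_(n, 1 + m)) 0 1%:M =
      block_mx A (row_mx 0 0) (col_mx 0 0) (block_mx (1%:M : 'M_1) 0 0 1%:M).
    by rewrite row_mx0 col_mx0 -scalar_mx_block.
  rewrite block_mxA; congr castmx.
  by rewrite row_mx0 col_mx0.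
by rewrite (@row_mxA _ _ _ 1 m); congr castmx.
Qed.

Lemma same_reindexed n n' (A : 'M[int]_n) W (F : 'M_(n, n')) (F' : 'M_(n', n)) :
  F *m F' = 1%:M -> F' *m F = 1%:M ->
  same_system (System A W) (System (F' *m A *m F) (W *m F)).
Proof.
move=> FF' F'F; have e : n = n'.
  by apply/eqP; rewrite eqn_leq (mulmx1_min FF') (mulmx1_min F'F).
case: n' / e in F F' FF' F'F *; have [uF uF'] := mulmx1_unit FF'.
apply: rst_trans (same_rows _ _ (elemprod_of_unit uF')) _.
exact: same_columns.
Qed.

(** An added unknown s that vanishes may occur in the color forms; substituting
[s + A x] for it changes them by multiples of the equations. *)
Lemma same_shifted n (A : 'M[int]_n) W (Y : 'M_(2, n)) :
  same_system (System A W) (System A (W + Y *m A)).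
Proof.
apply: rst_trans (same_enlarged A W Y) _.
apply: rst_sym; apply: rst_trans (same_enlarged A (W + Y *m A) Y) _.
apply: rst_sym.
have uF (M : 'M[int]_n) : block_mx 1%:M 0 M 1%:M \in unitmx.
  by rewrite unitmxE det_lblock !det1 mulr1 unitr1.
apply: rst_trans (same_columns _ _ (uF A)) _.
rewrite mulmx_block mul_row_block !mulblockE.
apply: rst_trans (same_rows _ _ (elemprod_of_unit (uF (- 1%:M)))) _.
rewrite mulmx_block !mulblockE mulNmx mul1mx addNr.
exact: rst_refl.
Qed.

(** Both systems are enlarged to the size of the two block matrices of
[common_presentation], which differ by row operations only. *)
Lemma same_solutions n (A : 'M[int]_n) (B : 'M[int]_2)
    (W : 'M_(2, n)) (P : 'M_(n, 2)) :
  int_comb (A *m P) B -> int_comb (B *m W) A ->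
  int_comb (1%:M - P *m W) A -> int_comb (1%:M - W *m P) B ->
  same_system (System A W) (System B 1%:M).
Proof.
move=> h1 h2 h3 h4; have [E hE eqE] := common_presentation h1 h2 h3 h4.
have [Y eqY] := h4.
have uL : block_mx 1%:M 0 (- W) 1%:M \in unitmx.
  by rewrite unitmxE det_lblock !det1 mulr1 unitr1.
have uR : block_mx 1%:M (- P) 0 1%:M \in unitmx.
  by rewrite unitmxE det_ublock !det1 mulr1 unitr1.
apply: rst_trans (same_enlarged A W (0 : 'M_2)) _.
apply: rst_trans (same_columns _ _ uL) _.
apply: rst_trans (same_rows _ _ hE) _.
rewrite mulmx_block mul_row_block !mulblockE -eqE.
apply: rst_sym.
(* Color forms (W, W P) become (W, 0) under the substitution of x - P y for x. *)
apply: rst_trans (same_shifted B 1%:M (- Y)) _.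
apply: rst_trans (same_enlarged B _ W) _.
pose F : 'M[int]_(2 + n, n + 2) := block_mx 0 1%:M 1%:M 0.
pose F' : 'M[int]_(n + 2, 2 + n) := block_mx 0 1%:M 1%:M 0.
have FF' : F *m F' = 1%:M by rewrite mulmx_block !mulblockE -scalar_mx_block.
have F'F : F' *m F = 1%:M by rewrite mulmx_block !mulblockE -scalar_mx_block.
apply: rst_trans (same_reindexed _ _ FF' F'F) _.
rewrite !mulmx_block mul_row_block !mulblockE.
apply: rst_trans (same_columns _ _ uR) _.
rewrite mulmx_block mul_row_block !mulblockE.
rewrite mulNmx -eqY mulmxN opprB [1%:M + _]addrC subrK addNr.
exact: rst_refl.
Qed.

(** * Counting the components of a graph *)

(** The functions on T that are constant along the edges form the kernel of a
linear map into a space of dimension [size es], hence a space of dimension at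
least [#|T| - size es]; they are combinations of the indicators of the
components. *)
Lemma card_components (T : finType) (e : rel T) (es : seq (T * T)) :
  connect_sym e ->
  (forall s t, e s t -> ((s, t) \in es) || ((t, s) \in es)) ->
  (#|T| <= #|equivalence_partition (connect e) [set: T]| + size es)%N.
Proof.
move=> sym_e e_es; set P := equivalence_partition _ _.
have eqr : {in [set: T] & &, equivalence_rel (connect e)}.
  by move=> x y z _ _ _; apply: (equivalence_relP _).2 => //; split;
    [apply: connect0 | move=> *; apply: same_connect].
pose J : 'M[rat]_(#|T|, size es) := \matrix_(i, k)
  ((enum_val i == (tnth (in_tuple es) k).1)%:R -
   (enum_val i == (tnth (in_tuple es) k).2)%:R).
pose X : 'M[rat]_(#|P|, #|T|) := 
  \matrix_(b < #|P|, i < #|T|) (enum_val i \in (enum_val b : {set T}))%:R.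
suff le_ker : (kermx J <= X)%MS.
  have := leq_trans (mxrankS le_ker) (rank_leq_row X).
  by rewrite mxrank_ker; have := rank_leq_col J; lia.
apply/row_subP=> i0; have : row i0 (kermx J) *m J = 0.
  by rewrite -row_mul mulmx_ker row0.
move: (row i0 _) => v vJ {i0}.
pose f x := v 0 (enum_rank x).
have f_edge s t : (s, t) \in es -> f s = f t.
  move=> st; have lt_k : (index (s, t) es < size es)%N by rewrite index_mem.
  move/(congr1 (fun u : 'rV_ _ => u 0 (Ordinal lt_k))): vJ.
  have sumE x : \sum_i v 0 i * (enum_val i == x)%:R = f x.
    rewrite (bigD1 (enum_rank x)) //= enum_rankK eqxx mulr1 big1 ?addr0 // => i.
    by rewrite -(inj_eq enum_val_inj) enum_rankK => /negPf ->; rewrite mulr0.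
  rewrite !mxE (eq_bigr (fun i => v 0 i * (enum_val i == s)%:R
                               - v 0 i * (enum_val i == t)%:R)).
    by rewrite sumrB !sumE => /eqP; rewrite subr_eq0 => /eqP.
  by move=> i _; rewrite mxE (tnth_nth (s, t)) /= nth_index // mulrBr.
have f_connect x y : connect e x y -> f x = f y.
  case/connectP=> q + ->; elim: q x => //= z q IH x /andP[/e_es xz /IH <-].
  by case/orP: xz => /f_edge.
apply/submxP.
pose rep (b : {set T}) := odflt 0 (omap f [pick x in b]).
exists (\row_b rep (enum_val b)); apply/rowP=> i; rewrite !mxE.
have /and3P[/eqP covP trivP _] := equivalence_partitionP eqr.
have x_in : enum_val i \in cover P by rewrite covP.
pose b := pblock P (enum_val i).
have bP : b \in P by apply: pblock_mem.
rewrite (bigD1 (enum_rank_in bP b)) //= !mxE enum_rankK_in //.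
rewrite mem_pblock x_in mulr1 big1 ?addr0 => [|b' nb]; last first.
  rewrite !mxE; case: (boolP (_ \in _)) => [x_b'|]; last by rewrite mulr0.
  case/eqP: nb; apply: enum_val_inj; rewrite enum_rankK_in //.
  by rewrite /b (def_pblock trivP (enum_valP b') x_b').
rewrite /rep; case: pickP => [x /=|/(_ (enum_val i))]; last first.
  by rewrite mem_pblock x_in.
rewrite pblock_equivalence_partition // => /f_connect <-.
by rewrite /f enum_valK.
Qed.

(** * Colorings of four-strand diagrams *)

(** How the values of t on the four positions change from above to below a
crossing. *)
Definition crossing_step (t : nat -> int) (c : crossing) : nat -> int :=
  fun q => if q == under_bot c then t (over_top c) *+ 2 - t (under_top c)
           else if q == over_bot c then t (over_top c) else t q.

Definition top_coord (q : nat) : int := (q < 2)%:R.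

Section FourStrands.
Variable D : diagram.
Hypothesis wfD : all (fun c => cleft c < 3)%N (word D).

Local Notation L := (ncross D).
Local Notation A := (coloring_matrix D).
Local Notation W := (colors (coloring_system D)).

Definition level_coord (l : nat) : nat -> int :=
  foldl crossing_step top_coord (take l (word D)).

Lemma level_coordS l : (l < L)%N ->
  level_coord l.+1 = crossing_step (level_coord l) (cross D l).
Proof.
move=> ltl; rewrite /level_coord (take_nth (Crossing 0 true)) //.
by rewrite -cats1 foldl_cat.
Qed.

Lemma cleft_cross l : (l < L)%N -> (cleft (cross D l) < 3)%N.
Proof. by move=> ltl; exact: (all_nthP (Crossing 0 true) wfD). Qed.

Lemma same_arc_sym : connect_sym (fun s t : segment D => joined s t || joined t s).
Proof. by apply: sym_connect_sym => s t; rewrite orbC. Qed.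

Lemma same_arc_equiv : {in [set: segment D] & &, equivalence_rel (@same_arc D)}.
Proof.
move=> x y z _ _ _; split=> [|xy]; first exact: connect0.
exact: (same_connect same_arc_sym).
Qed.

Definition strand_edges (l : nat) : seq (segment D * segment D) :=
  [seq (seg D l q, seg D l.+1 r) | q <- iota 0 4,
     r <- [seq r <- iota 0 4 | passes (cross D l) q r]].

(** Of the four segments above a crossing, three are continued by a segment below
it; this gives three edges for each crossing, and the caps and the closure give four
more. *)
Lemma ncross_le_arcs : (L <= #|arcs D|)%N.
Proof.
pose edges := flatten [seq strand_edges l | l <- iota 0 L] ++
  [seq (seg D 0 qr.1, seg D 0 qr.2) | qr <- [:: (0, 1); (2, 3)]%N] ++
  [seq (seg D L qr.1, seg D L qr.2) |
     qr <- match closing D with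
           | Numerator => [:: (0, 1); (2, 3)]%N
           | Denominator => [:: (1, 2); (0, 3)]%N
           end].
have size_edges : (size edges <= 3 * L + 4)%N.
  rewrite !size_cat !size_map addnA; have -> : size (match closing D with
           | Numerator => [:: (0, 1); (2, 3)]%N
           | Denominator => [:: (1, 2); (0, 3)]%N
           end) = 2 by case: closing.
  rewrite -addnA leq_add2r size_flatten /shape -map_comp sumnE big_map.
  rewrite -{2}[L](size_iota 0) -sum1_size big_distrr /=.
  rewrite !big_seq; apply: leq_sum => l; rewrite mem_iota /= => ltl.
  have := cleft_cross ltl; rewrite /strand_edges /passes.
  rewrite /over_top /over_bot.
  by case: (cross D l) => [[|[|[|?]]] []].
have seg_eta (s : segment D) : s = seg D s.1 s.2.
  by case: s => l q; rewrite /seg !inord_val.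
have joined_edges (s t : segment D) : joined s t -> (s, t) \in edges.
  rewrite {2}(seg_eta s) {2}(seg_eta t); case: s t => l q [m r] /=.
  rewrite !mem_cat; case/or3P=> [/andP[lm st]|/and3P[l0 m0 st]|/and3P[lL mL st]].
  - apply/orP; left; apply/flattenP; exists (strand_edges l).
      apply: map_f; have := ltn_ord m; rewrite mem_iota (eqP lm) /=; lia.
    apply/allpairsPdep; exists (val q), (val r); rewrite mem_filter st.
    by rewrite !mem_iota (eqP lm) /= !ltn_ord.
  - apply/orP; right; apply/orP; left; apply/mapP; exists (val q, val r) => //.
    by rewrite /= (eqP l0) (eqP m0).
  - apply/orP; right; apply/orP; right; apply/mapP; exists (val q, val r).
      by move: st; rewrite /closed_up; case: closing.
    by rewrite /= (eqP lL) (eqP mL).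
have := @card_components _ _ edges same_arc_sym.
rewrite card_prod !card_ord => le_card.
suff : (L.+1 * 4 <= #|arcs D| + size edges)%N by lia.
apply: le_card => s t /orP[/joined_edges->//|/joined_edges->]; exact: orbT.
Qed.

(** The color of the segment s as a linear form in the unknowns. *)
Definition arc_form (s : segment D) : 'rV[int]_#|arcs D| :=
  \row_k (s \in (enum_val k : {set segment D}))%:R.

Lemma arc_form_same s s' : same_arc s s' -> arc_form s = arc_form s'.
Proof.
move=> ss'; apply/rowP=> k; rewrite !mxE; have /imsetP[x _ ->] := enum_valP k.
rewrite !inE /=; congr (nat_of_bool _)%:R.
exact: (same_connect_r same_arc_sym ss' x).
Qed.

Lemma joined_same_arc (s t : segment D) : joined s t -> same_arc s t.
Proof. by move=> st; apply: connect1; rewrite st. Qed.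

Lemma arc_form_pass l q r : (l < L)%N -> (q < 4)%N -> (r < 4)%N ->
  passes (cross D l) q r -> arc_form (seg D l q) = arc_form (seg D l.+1 r).
Proof.
move=> ltl q4 r4 qr; apply/arc_form_same/joined_same_arc; rewrite /joined /seg.
by rewrite !inordK // ?eqxx ?qr // ltnW.
Qed.

Lemma arc_form_cap q r : (q < 4)%N -> (r < 4)%N -> capped q r ->
  arc_form (seg D 0 q) = arc_form (seg D 0 r).
Proof.
move=> q4 r4 qr; apply/arc_form_same/joined_same_arc; rewrite /joined /seg.
by rewrite !inordK // ?eqxx ?qr //= orbT.
Qed.

Lemma arc_form_closed q r : (q < 4)%N -> (r < 4)%N -> closed_up D q r ->
  arc_form (seg D L q) = arc_form (seg D L r).
Proof.
move=> q4 r4 qr; apply/arc_form_same/joined_same_arc; rewrite /joined /seg.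
by rewrite !inordK // ?eqxx ?qr //= !orbT.
Qed.

Definition crossing_form (l : nat) : 'rV[int]_#|arcs D| :=
  arc_form (seg D l (over_top (cross D l))) *+ 2
  - arc_form (seg D l (under_top (cross D l)))
  - arc_form (seg D l.+1 (under_bot (cross D l))).

Lemma row_coloring_matrix (i : 'I_#|arcs D|) :
  row i A = if (i < L)%N then crossing_form i else 0.
Proof.
apply/rowP=> k; rewrite !mxE; case: ifP => _; last by rewrite mxE.
by rewrite !mxE /crossing_coef.
Qed.

Lemma crossing_form_comb l : (l < L)%N -> int_comb (crossing_form l) A.
Proof.
move=> ltl; have lt_arcs := leq_trans ltl ncross_le_arcs.
by have := int_comb_row A (Ordinal lt_arcs); rewrite row_coloring_matrix /= ltl.
Qed.

(** The form [t b + (1 - t) a] in the unknowns b, a. *)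
Definition affine_form (t : int) : 'rV[int]_2 :=
  \row_j (if j == 0 then t else 1 - t).

Lemma row_colors i : row i W = arc_form (seg D 0 (if i == 0 then 0%N else 2%N)).
Proof. by apply/rowP=> k; rewrite !mxE. Qed.

Lemma affine_form_mul t : affine_form t *m W =
  t *: arc_form (seg D 0 0) + (1 - t) *: arc_form (seg D 0 2).
Proof.
by apply/rowP=> k; rewrite !mxE !big_ord_recl big_ord0 addr0 !mxE.
Qed.

Lemma affine_form_under s t :
  affine_form (s *+ 2 - t) = affine_form s *+ 2 - affine_form t.
Proof. by apply/rowP=> j; rewrite !mxE; case: (j == 0) => //; lia. Qed.

Lemma crossing_cases l (Q : nat -> Prop) : (l < L)%N ->
  let c := cross D l in
  Q (under_bot c) -> Q (over_bot c) ->
  (forall q, (q < 4)%N -> passes c q q ->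
     q != under_bot c -> q != over_bot c -> Q q) ->
  forall q, (q < 4)%N -> Q q.
Proof.
move=> ltl c Qu Qo Qq q q4; have [->|qu] := eqVneq q (under_bot c) => //.
have [->|qo] := eqVneq q (over_bot c) => //; apply: Qq => //.
move: qu qo; rewrite /passes /under_bot /over_bot !inE.
by case: (over_ul c) => /negPf qu /negPf qo; rewrite qu qo eqxx.
Qed.

Lemma strand_bounds l : (l < L)%N -> let c := cross D l in
  [/\ over_top c < 4, over_bot c < 4, under_top c < 4, under_bot c < 4 &
      passes c (over_top c) (over_bot c)]%N.
Proof.
move=> ltl c; have := cleft_cross ltl; rewrite -/c /passes.
rewrite /over_top /over_bot /under_top /under_bot !inE.
by case: (over_ul c); rewrite !eqxx ?orbT => ?; split=> //; lia.
Qed.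

(** Every color is determined by the cap colors, by induction on the level: the
equation of a crossing gives the color of its lower under-end. *)
Lemma arc_form_coord l q : (l <= L)%N -> (q < 4)%N ->
  int_comb (arc_form (seg D l q) - affine_form (level_coord l q) *m W) A.
Proof.
elim: l q => [|l IH] q leL; last first.
  have [ot4 ob4 ut4 ub4 ot_ob] := strand_bounds leL.
  move: q; apply: (crossing_cases leL) => [||q q4 qq qu qo].
  - have -> : arc_form (seg D l.+1 (under_bot (cross D l))) =
        2 *: arc_form (seg D l (over_top (cross D l)))
        - arc_form (seg D l (under_top (cross D l))) - crossing_form l.
      by rewrite /crossing_form scaler_nat opprB addrC subrK.
    rewrite level_coordS // /crossing_step eqxx affine_form_under -scaler_nat.
    rewrite mulmxBl -scalemxAl.
    set x := arc_form _; set y := arc_form _; set z := crossing_form _.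
    set x' := _ *m _; set y' := _ *m _.
    have -> : 2 *: x - y - z - (2 *: x' - y') = 2 *: (x - x') - (y - y') - z.
      by clearbody x y z x' y'; apply/rowP=> k; rewrite !mxE; ring.
    apply: int_combB; last exact: crossing_form_comb.
    by apply: int_combB; [apply: int_combZ|]; apply: IH => //; apply: ltnW.
  - rewrite -(arc_form_pass leL ot4 ob4 ot_ob) level_coordS // /crossing_step.
    have /negPf-> : over_bot (cross D l) != under_bot (cross D l).
      by rewrite /over_bot /under_bot; case: (over_ul _); lia.
    by rewrite eqxx; apply: IH => //; apply: ltnW.
  - rewrite -(arc_form_pass leL q4 q4 qq) level_coordS // /crossing_step.
    rewrite (negPf qu) (negPf qo).
    by apply: IH => //; apply: ltnW.
have cap01 := @arc_form_cap 0 1 isT isT isT.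
have cap23 := @arc_form_cap 2 3 isT isT isT.
rewrite affine_form_mul /level_coord take0 /= /top_coord.
case: q leL => [|[|[|[|//]]]] _ _; rewrite ?cap01 -?cap23
  !(scale1r, scale0r, subrr, subr0, addr0, add0r).
all: exact: int_comb0.
Qed.

(** By [alternating_coord], the differences of t for the two pairs of positions
that the closure joins are this number and its opposite, or this number twice. *)
Definition bottom_gap : int :=
  level_coord L 1%N
  - level_coord L (if closing D is Numerator then 0%N else 2%N).

(** A crossing changes two neighbouring values, and keeps their difference. *)
Lemma alternating_coord l : (l <= L)%N ->
  level_coord l 0%N - level_coord l 1%N
  + level_coord l 2%N - level_coord l 3%N = 0.
Proof.
elim: l => [|l IH] leL; first by rewrite /level_coord take0.
move: (IH (ltnW leL)); rewrite level_coordS //; move: (level_coord l) => t.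
have := cleft_cross leL.
rewrite /crossing_step /under_bot /over_bot /over_top /under_top.
by case: (cross D l) => [[|[|[|//]]] []] _ /=; lia.
Qed.

Lemma closed_up_gap q r : closed_up D q r ->
  (bottom_gap %| level_coord L q - level_coord L r)%Z.
Proof.
have := alternating_coord (leqnn L); rewrite /bottom_gap /closed_up.
move: (level_coord L) => t alt; case: closing; rewrite !inE !xpair_eqE;
  case/orP=> /andP[/eqP-> /eqP->].
- by rewrite -opprB rpredN.
- by have -> : t 2%N - t 3%N = t 1%N - t 0%N by lia.
- by [].
- by have -> : t 0%N - t 3%N = t 1%N - t 2%N by lia.
Qed.

Lemma passes_coord l q r : (l < L)%N -> (q < 4)%N -> (r < 4)%N ->
  passes (cross D l) q r -> level_coord l.+1 r = level_coord l q.
Proof.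
move=> ltl q4 r4; rewrite level_coordS //; have := cleft_cross ltl.
move: (level_coord l) => t.
rewrite /passes /crossing_step /under_bot /over_bot /over_top /under_top !inE.
case: (cross D l) => c [] /= _; case: ifP => [_ /andP[/eqP-> /eqP->]|].
- by rewrite eqxx; case: eqP => //; lia.
- by move=> /negbT; rewrite negb_or => /andP[/negPf qc /negPf qc1] /eqP->;
    rewrite qc qc1.
- by rewrite eqxx; case: eqP => //; lia.
- by move=> /negbT; rewrite negb_or => /andP[/negPf qc /negPf qc1] /eqP->;
    rewrite qc qc1.
Qed.

(** The value of t on an arc may depend on the level where it is read off, but only
the closure causes this. *)
Lemma same_arc_coord (s t : segment D) : same_arc s t ->
  (bottom_gap %| level_coord s.1 s.2 - level_coord t.1 t.2)%Z.
Proof.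
have joined_coord (x y : segment D) : joined x y ->
    (bottom_gap %| level_coord x.1 x.2 - level_coord y.1 y.2)%Z.
  case: x y => l q [m r] /=.
  case/or3P=> [/andP[/eqP lm st]|/and3P[/eqP-> /eqP-> st]|].
  - rewrite lm (passes_coord _ _ _ st) ?subrr ?dvdz0 //.
    by have := ltn_ord m; rewrite lm.
  - have -> : level_coord 0 q = level_coord 0 r; last by rewrite subrr dvdz0.
    rewrite /level_coord take0 /=.
    by move: st; rewrite /capped !inE !xpair_eqE => /orP[] /andP[/eqP-> /eqP->].
  - by case/and3P=> /eqP-> /eqP-> /closed_up_gap.
case/connectP=> p + ->; elim: p s => [|y p IH] s /=; first by rewrite subrr dvdz0.
case/andP=> sy /IH yt; rewrite -(subrKA (level_coord y.1 y.2)); apply: rpredD yt.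
by case/orP: sy => /joined_coord //; rewrite -opprB rpredN.
Qed.

(** By [same_arc_coord], the choice of the segment matters only modulo
[bottom_gap]. *)
Definition arc_coord (k : 'I_#|arcs D|) : int :=
  if [pick s in (enum_val k : {set segment D})] is Some s
  then level_coord s.1 s.2 else 0.

Local Notation B := (eqns (bma_system bottom_gap)).

Definition arc_coords : 'M[int]_(#|arcs D|, 2) :=
  \matrix_k affine_form (arc_coord k).

Lemma int_comb_gap t u : (bottom_gap %| t - u)%Z ->
  int_comb (affine_form t - affine_form u) B.
Proof.
case/dvdzP=> x eqx; exists (x *: delta_mx 0 0); rewrite -scalemxAl -rowE.
apply/rowP=> j; rewrite !mxE /=; case: (j == 0) => //; lia.
Qed.

Lemma arc_of_segment s :
  exists k : 'I_#|arcs D|, s \in (enum_val k : {set segment D}).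
Proof.
have /and3P[/eqP covP _ _] := equivalence_partitionP same_arc_equiv.
have s_in : s \in cover (arcs D) by rewrite covP.
have bP := pblock_mem s_in; exists (enum_rank_in bP (pblock (arcs D) s)).
by rewrite enum_rankK_in // mem_pblock.
Qed.

Lemma arc_form_delta (k : 'I_#|arcs D|) s :
  s \in (enum_val k : {set segment D}) -> arc_form s = delta_mx 0 k.
Proof.
have /and3P[_ trivP _] := equivalence_partitionP same_arc_equiv.
move=> sk; apply/rowP=> k'; rewrite !mxE /=; congr (nat_of_bool _)%:R.
apply/idP/eqP => [sk'|-> //]; apply: enum_val_inj.
rewrite -(def_pblock trivP (enum_valP k) sk).
by rewrite (def_pblock trivP (enum_valP k') sk').
Qed.

Lemma segment_of_arc (k : 'I_#|arcs D|) :
  exists2 s : segment D, s \in (enum_val k : {set segment D}) &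
  arc_coord k = level_coord s.1 s.2.
Proof.
rewrite /arc_coord; case: pickP => [s sk|none]; first by exists s.
have := enum_valP k; case/imsetP=> x _ eqx; have := none x.
by rewrite eqx !inE /same_arc connect0.
Qed.

Lemma mem_same_arc (k : 'I_#|arcs D|) (s t : segment D) :
  s \in (enum_val k : {set segment D}) ->
  t \in (enum_val k : {set segment D}) -> same_arc s t.
Proof.
have /imsetP[x _ ->] := enum_valP k; rewrite !inE /= => xs.
by rewrite [same_arc x t](same_connect same_arc_sym xs).
Qed.

Lemma arc_form_mul_coords (s : segment D) :
  int_comb (arc_form s *m arc_coords - affine_form (level_coord s.1 s.2)) B.
Proof.
have [k sk] := arc_of_segment s; rewrite (arc_form_delta sk) -rowE rowK.
have [t tk ->] := segment_of_arc k.
exact/int_comb_gap/same_arc_coord/(mem_same_arc tk sk).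
Qed.

Lemma arc_form_mul_coords_seg l q : (l <= L)%N -> (q < 4)%N ->
  int_comb
    (arc_form (seg D l q) *m arc_coords - affine_form (level_coord l q)) B.
Proof.
move=> leL q4; have := arc_form_mul_coords (seg D l q).
by rewrite /= !inordK.
Qed.

Lemma coloring_mul_coords : int_comb (A *m arc_coords) B.
Proof.
apply: int_comb_rows => i; rewrite row_mul row_coloring_matrix.
case: ifP => [ltl|_]; last by rewrite mul0mx; apply: int_comb0.
have [ot4 ob4 ut4 ub4 _] := strand_bounds ltl.
have ho := arc_form_mul_coords_seg (ltnW ltl) ot4.
have hu := arc_form_mul_coords_seg (ltnW ltl) ut4.
have hb := arc_form_mul_coords_seg ltl ub4.
have := int_combB (int_combB (int_combZ 2 ho) hu) hb.
rewrite level_coordS // /crossing_step eqxx affine_form_under /crossing_form !mulmxBl.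
rewrite -!scaler_nat -!scalemxAl.
set x := _ *m _; set y := _ *m _; set z := _ *m _.
set x' := affine_form _; set y' := affine_form _.
congr int_comb; clearbody x y z x' y'; apply/rowP=> k; rewrite !mxE; ring.
Qed.

(** Two segments joined by the closure have the same color; comparing their
expressions in b and a gives the equation [(b - a) c = 0]. *)
Lemma gap_mul_colors : int_comb (B *m W) A.
Proof.
apply: int_comb_rows => i; rewrite row_mul.
have [->|i0] := eqVneq i 0; last first.
  have -> : row i B = 0 by apply/rowP=> j; rewrite !mxE (negPf i0).
  by rewrite mul0mx; apply: int_comb0.
have gap q r : (q < 4)%N -> (r < 4)%N -> closed_up D q r ->
    int_comb
      ((affine_form (level_coord L q) - affine_form (level_coord L r)) *m W) A.
  move=> q4 r4 qr; have hq := arc_form_coord (leqnn L) q4.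
  have hr := arc_form_coord (leqnn L) r4.
  have := int_combB hr hq; rewrite -(arc_form_closed q4 r4 qr) mulmxBl.
  by rewrite opprB [X in int_comb X]addrC subrKA.
have -> : row 0 B = if closing D is Numerator
    then
      - 1 *: (affine_form (level_coord L 0%N) - affine_form (level_coord L 1%N))
    else affine_form (level_coord L 1%N) - affine_form (level_coord L 2%N).
  apply/rowP=> j; rewrite !mxE eqxx /bottom_gap; case: closing; rewrite !mxE;
    case: (j == 0); lia.
move: gap; rewrite /closed_up; case: closing => gap; last exact: gap.
by rewrite -scalemxAl; apply: int_combZ; apply: gap.
Qed.

Lemma arc_coords_mul_colors : int_comb (1%:M - arc_coords *m W) A.
Proof.
apply: int_comb_rows => k; rewrite raddfB /= row1 row_mul rowK.
have [[l q] sk eqk] := segment_of_arc k; rewrite eqk /=.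
rewrite -(arc_form_delta sk).
have -> : (l, q) = seg D l q by rewrite /seg !inord_val.
by apply: arc_form_coord; [rewrite -ltnS|].
Qed.

Lemma colors_mul_coords : int_comb (1%:M - W *m arc_coords) B.
Proof.
apply: int_comb_rows => i; rewrite raddfB /= row1 row_mul row_colors.
have coordE q : (q < 4)%N -> int_comb
    (affine_form (top_coord q) - arc_form (seg D 0 q) *m arc_coords) B.
  move=> q4; have := int_combZ (-1) (arc_form_mul_coords_seg (leq0n L) q4).
  by rewrite scaleN1r opprB /level_coord take0.
have -> : delta_mx 0 i = affine_form (top_coord (if i == 0 then 0%N else 2%N)).
  by apply/rowP; case: i => [[|[|//]] i2]; case=> [[|[|//]] j2]; rewrite !mxE.
by apply: coordE; case: ifP.
Qed.

Theorem coloring_system_gap : is_cse D (bma_system bottom_gap).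
Proof.
exact: same_solutions coloring_mul_coords gap_mul_colors arc_coords_mul_colors
  colors_mul_coords.
Qed.

(** * The determinant of a four-strand diagram *)

(** The sign that the checkerboard shading gives to the crossing, up to an overall
sign. *)
Definition checker_sign (c : crossing) : int := (-1) ^+ (cleft c + ~~ over_ul c).

Definition alternating_form (l : nat) : 'rV[int]_#|arcs D| :=
  arc_form (seg D l 0) - arc_form (seg D l 1)
  + arc_form (seg D l 2) - arc_form (seg D l 3).

(** The equation of a crossing says that the alternating sum of the colors is the
same above and below it. *)
Lemma checker_sign_crossing l : (l < L)%N ->
  checker_sign (cross D l) *: crossing_form l =
  alternating_form l - alternating_form l.+1.
Proof.
move=> ltl; have pass q r := @arc_form_pass l q r ltl.
move: pass (cleft_cross ltl).
rewrite /crossing_form /alternating_form /checker_sign.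
rewrite /passes /over_top /over_bot /under_top /under_bot.
case: (cross D l) => [[|[|[|//]]] []] pass _ /=.
- rewrite (pass 0 1)%N ?(pass 2 2)%N ?(pass 3 3)%N //;
    apply/rowP=> k; rewrite !mxE; ring.
- rewrite (pass 1 0)%N ?(pass 2 2)%N ?(pass 3 3)%N //;
    apply/rowP=> k; rewrite !mxE; ring.
- rewrite (pass 1 2)%N ?(pass 0 0)%N ?(pass 3 3)%N //;
    apply/rowP=> k; rewrite !mxE; ring.
- rewrite (pass 2 1)%N ?(pass 0 0)%N ?(pass 3 3)%N //;
    apply/rowP=> k; rewrite !mxE; ring.
- rewrite (pass 2 3)%N ?(pass 0 0)%N ?(pass 1 1)%N //;
    apply/rowP=> k; rewrite !mxE; ring.
- rewrite (pass 3 2)%N ?(pass 0 0)%N ?(pass 1 1)%N //;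
    apply/rowP=> k; rewrite !mxE; ring.
Qed.

(** The sum telescopes, and both closures make the alternating sum vanish. Rows of
A beyond the crossings are zero, so their coefficients are arbitrary; here they
are signs as well, which is used in [redundant_row]. *)
Lemma checkerboard_relation :
  \sum_(i < #|arcs D|) checker_sign (cross D i) *: row i A = 0.
Proof.
under eq_bigr => i _ do rewrite row_coloring_matrix.
transitivity (\sum_(i < #|arcs D| | (i < L)%N)
   (alternating_form i - alternating_form i.+1)).
  rewrite [RHS]big_mkcond /=; apply: eq_bigr => i _; case: ifP => [ltl|_].
    exact: checker_sign_crossing.
  by rewrite scaler0.
rewrite -(big_ord_widen _ (fun i => alternating_form i - alternating_form i.+1)
  ncross_le_arcs).
rewrite -(big_mkord xpredT (fun i => alternating_form i - alternating_form i.+1)).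
under eq_bigr => l _ do rewrite -opprB.
rewrite sumrN telescope_sumr // /alternating_form.
rewrite (arc_form_cap _ _ (isT : capped 0 1)) //.
rewrite (arc_form_cap _ _ (isT : capped 2 3)) // subrr add0r subrr subr0.
have eqL := @arc_form_closed; move: eqL; rewrite /closed_up.
case: closing => eqL.
  by rewrite (eqL 0 1)%N // (eqL 2 3)%N // subrr add0r subrr oppr0.
by rewrite (eqL 0 3)%N // (eqL 1 2)%N // subrK subrr oppr0.
Qed.

Lemma redundant_row i (A' : 'M[int]_#|arcs D|) :
  (forall a, a != i -> row a A' = row a A) -> int_comb A A'.
Proof.
move=> eqA'; have comb a : a != i -> int_comb (row a A) A'.
  by move=> ai; rewrite -eqA' //; apply: int_comb_row.
apply: int_comb_rows => a; have [->{a}|] := eqVneq a i; last exact: comb.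
have := checkerboard_relation; rewrite (bigD1 i) //= => /eqP.
rewrite addr_eq0 => /eqP /(congr1 (fun v => checker_sign (cross D i) *: v)).
rewrite scalerA -expr2 sqrr_sign scale1r => ->.
apply: int_combZ; rewrite -scaleN1r; apply: int_combZ.
elim/big_rec: _ => [|a v ai hv]; first exact: int_comb0.
by apply: int_combD hv; apply/int_combZ/comb.
Qed.

Theorem coloring_det_gap : is_det D `|bottom_gap|.
Proof.
move=> i j.
pose A' : 'M[int]_#|arcs D| := \matrix_a if a == i then delta_mx 0 j else row a A.
pose B' : 'M[int]_2 := \matrix_b
  if b == 0 then row 0 B else affine_form (arc_coord j).
have AA' : int_comb A A'.
  by apply: (@redundant_row i) => a ai; rewrite rowK (negPf ai).
have BB' : int_comb B B'.
  apply: int_comb_rows => b; have [->|b0] := eqVneq b 0.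
    by have := int_comb_row B' 0; rewrite rowK eqxx.
  have -> : row b B = 0 by apply/rowP=> k; rewrite !mxE (negPf b0).
  exact: int_comb0.
have eiA' : int_comb (delta_mx 0 j : 'rV_#|arcs D|) A'.
  by have := int_comb_row A' i; rewrite rowK eqxx.
have -> : \det (row' i (col' j A)) = (-1) ^+ (i + j) * \det A'.
  rewrite (expand_det_row A' i) (bigD1 j) //= big1 ?addr0 => [|k kj]; last first.
    by rewrite !mxE eqxx mxE (negPf kj) andbF mul0r.
  rewrite /cofactor !mxE eqxx mxE !eqxx mul1r mulrA -expr2 sqrr_sign mul1r.
  congr (\det _); apply/matrixP=> a b; rewrite !mxE.
  by rewrite eq_sym (negPf (neq_lift _ _)) !mxE.
rewrite normrM normrX normrN1 expr1n mul1r.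
have detB' : \det B' = bottom_gap.
  rewrite (expand_det_row B' 0) !big_ord_recl big_ord0 addr0.
  rewrite /cofactor !det_mx11 !mxE /=.
  ring.
(* W and P stay mutually inverse on the colorings that vanish on the arc j. *)
rewrite -detB'; apply: (@same_abs_det _ _ A' B' W arc_coords).
- apply: int_comb_rows => a; rewrite row_mul rowK; case: eqP => _.
    rewrite -rowE rowK.
    by have := int_comb_row B' 1; rewrite rowK.
  apply: int_comb_trans BB'; rewrite -row_mul.
  exact: int_comb_trans (int_comb_row _ _) coloring_mul_coords.
- apply: int_comb_rows => b; rewrite row_mul rowK; case: eqP => _.
    apply: int_comb_trans AA'; rewrite -row_mul.
    exact: int_comb_trans (int_comb_row _ _) gap_mul_colors.
  have := int_comb_trans (int_comb_row _ j) arc_coords_mul_colors.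
  rewrite raddfB /= row1 row_mul rowK => /int_comb_trans /(_ AA').
  by move=> /(int_combB eiA'); rewrite opprB addrC subrK.
- exact: int_comb_trans arc_coords_mul_colors AA'.
- exact: int_comb_trans colors_mul_coords BB'.
Qed.
End FourStrands.

(** * Recursion for the polynomials *)

(** The sequences in IEO[N], as an explicit list: those that contain [N] arise
from a sequence of IEO[N - 1] in which the next place has the parity of [N]. *)
Fixpoint ieo_seqs (N : nat) : seq (seq nat) :=
  if N is M.+1 then
    ieo_seqs M ++ [seq rcons u M.+1 | u <- ieo_seqs M & odd (size u) == odd M]
  else [:: [::]].

Lemma ieo_rcons N u x :
  ieo N (rcons u x) =
  [&& ieo N u, all (ltn^~ x) u, 0 < x <= N & odd x == ~~ odd (size u)]%N.
Proof.
rewrite /ieo all_rcons !(sorted_pairwise ltn_trans) pairwise_rcons.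
rewrite size_rcons -cats1 -[(size u).+1]addn1 iotaD all_cat /= andbT add0n.
rewrite nth_cat ltnn subnn /=.
have -> :
     all (fun j => odd (nth 0%N (u ++ [:: x]) j) == ~~ odd j) (iota 0 (size u))
   = all (fun j => odd (nth 0%N u j) == ~~ odd j) (iota 0 (size u)).
  by apply: eq_in_all => j; rewrite mem_iota nth_cat => /andP[_ ->].
case: (all _ u); case: (all _ u); case: (pairwise _ _); case: (all _ _);
  by case: (_ <= _ <= _)%N => //=; rewrite ?andbF.
Qed.

Lemma ieo_bound N u : ieo N u -> all (leq^~ N) u.
Proof. by case/and3P=> /allP h _ _; apply/allP=> x /h /andP[]. Qed.

Lemma mem_ieo_seqs N u : (u \in ieo_seqs N) = ieo N u.
Proof.
elim: N u => [|N IH] u /=.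
  rewrite inE; case: u => [|x u] //; apply/esym/negbTE.
  by rewrite /ieo /= leqn0; case: x.
have ieoS v : ieo N.+1 v && all (ltn^~ N.+1) v = ieo N v.
  rewrite /ieo; case: sorted; rewrite ?andbF //.
  case: (all _ (iota _ _)); rewrite ?andbF //=.
  rewrite !andbT -all_predI; apply: eq_all => x /=; lia.
rewrite mem_cat IH; case: (lastP u) => [|v x].
  by rewrite /ieo.
rewrite !ieo_rcons; have [->|x_neq] := eqVneq x N.+1; last first.
  have -> : (rcons v x \in [seq rcons u N.+1 |
      u <- ieo_seqs N & odd (size u) == odd N]) = false.
    by apply/mapP=> -[w _ /rcons_inj[_ /eqP]]; rewrite (negPf x_neq).
  have -> : (x <= N.+1)%N = (x <= N)%N by rewrite leq_eqVlt (negPf x_neq).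
  rewrite orbF; case: (leqP x N) => xN; rewrite ?andbF //= -ieoS.
  have [lt_x|] := boolP (all (ltn^~ x) v); rewrite ?andbF //=.
  suff -> : all (ltn^~ N.+1) v by rewrite andbT.
  by apply: sub_all lt_x => y yx; apply: ltn_trans yx _.
rewrite ltnn ?andbF /= ?andbF /=.
have -> : (rcons v N.+1 \in [seq rcons u N.+1 |
      u <- ieo_seqs N & odd (size u) == odd N])
   = (odd (size v) == odd N) && ieo N v.
  rewrite (mem_map (@rcons_injl _ N.+1)) mem_filter IH //.
rewrite -ieoS leqnn andbC -andbA; congr [&& _, _ & _].
by case: (odd (size v)); case: (odd N).
Qed.

Lemma ieo_seqs_uniq N : uniq (ieo_seqs N).
Proof.
elim: N => //= N IH; rewrite cat_uniq IH map_inj_uniq ?filter_uniq //=.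
  rewrite andbT; apply/hasPn=> _ /mapP[v _ ->]; rewrite mem_ieo_seqs ieo_rcons ltnn.
  by rewrite !andbF.
exact: rcons_injl.
Qed.

Lemma ieo_size N u : ieo N u -> (size u <= N)%N.
Proof.
move=> ieou; have /and3P[/allP bound sorted_u _] := ieou.
rewrite -(size_iota 1 N); apply: uniq_leq_size.
  exact: (sorted_uniq ltn_trans ltnn).
by move=> x /bound; rewrite mem_iota add1n ltnS.
Qed.

Lemma sum_IEO n N (Q : pred nat) :
  \sum_(u in IEO N | Q (size u)) nmon n u =
  \sum_(u <- ieo_seqs N | Q (size u)) \prod_(i <- u) n i.
Proof.
pose f (u : N.-bseq 'I_N.+1) : seq nat := map val u.
have finj : injective f by move=> u v /(inj_map val_inj) /val_inj.
have perm : perm_eq (map f (enum (IEO N))) (ieo_seqs N).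
  apply: uniq_perm; first by rewrite map_inj_uniq ?enum_uniq.
    exact: ieo_seqs_uniq.
  move=> u; rewrite mem_ieo_seqs; apply/mapP/idP => [[v]|ieou].
    by rewrite mem_enum inE => ieov ->.
  have sz : (size [seq inord i : 'I_N.+1 | i <- u] <= N)%N.
    by rewrite size_map ieo_size.
  have uE : u = f (Bseq sz).
    rewrite /f /= -map_comp -[LHS]map_id; apply/eq_in_map=> x xu /=.
    by rewrite inordK // ltnS; apply: (allP (ieo_bound ieou)).
  by exists (Bseq sz); rewrite // mem_enum inE -/(f _) -uE.
rewrite -(perm_big _ perm) /= big_map big_enum_cond /=.
by apply: eq_big => [u|u _]; rewrite ?size_map // /nmon big_map.
Qed.

Lemma peE n N :
  pe n N = \sum_(u <- ieo_seqs N | ~~ odd (size u)) \prod_(i <- u) n i.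
Proof. exact: (sum_IEO n N (fun k => ~~ odd k)). Qed.

Lemma poE n N :
  po n N = \sum_(u <- ieo_seqs N | odd (size u)) \prod_(i <- u) n i.
Proof.
rewrite /po /p (bigID (fun u : N.-bseq _ => ~~ odd (size u))) /= -/(pe n N).
rewrite addrAC subrr add0r -(sum_IEO n N odd).
by apply: eq_bigl => u; rewrite negbK.
Qed.

(** A sequence that ends with [N.+1] has a length of the parity of [N.+1], so it
contributes to only one of the two sums. *)
Lemma sum_ieo_seqsS (n : nat -> int) N (b : bool) :
  \sum_(u <- ieo_seqs N.+1 | odd (size u) == b) \prod_(i <- u) n i =
  \sum_(u <- ieo_seqs N | odd (size u) == b) \prod_(i <- u) n i +
  (n N.+1 * \sum_(u <- ieo_seqs N | odd (size u) == odd N) \prod_(i <- u) n i)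
    *+ (b != odd N).
Proof.
rewrite /= big_cat /=; congr (_ + _); rewrite big_map big_filter_cond.
have [->|bN] := eqVneq b (odd N); rewrite ?mulr0n ?mulr1n.
  by rewrite big1 // => u; rewrite size_rcons /= => /andP[/eqP ->]; case: (odd N).
rewrite big_distrr /=; apply: eq_big => u.
  by rewrite size_rcons /=; move: bN; case: b; case: (odd (size u)); case: (odd N).
by move=> _; rewrite -cats1 big_cat big_seq1 mulrC.
Qed.

Lemma pe0 n : pe n 0 = 1.
Proof. by rewrite peE /ieo_seqs big_mkcond big_seq1 /= big_nil. Qed.

Lemma po0 n : po n 0 = 0.
Proof. by rewrite poE /ieo_seqs big_mkcond big_seq1. Qed.

Lemma peS n N : pe n N.+1 = pe n N + (if odd N then n N.+1 * po n N else 0).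
Proof.
rewrite !peE poE.
have E M : \sum_(u <- ieo_seqs M | ~~ odd (size u)) \prod_(i <- u) n i =
  \sum_(u <- ieo_seqs M | odd (size u) == false) \prod_(i <- u) n i.
  by apply: eq_bigl => u; case: odd.
rewrite !E sum_ieo_seqsS; case: (odd N); rewrite /= ?mulr0n ?mulr1n //.
by congr (_ + _ * _); apply: eq_bigl => u; case: odd.
Qed.

Lemma poS n N : po n N.+1 = po n N + (if odd N then 0 else n N.+1 * pe n N).
Proof.
rewrite !poE peE.
have E M : \sum_(u <- ieo_seqs M | odd (size u)) \prod_(i <- u) n i =
  \sum_(u <- ieo_seqs M | odd (size u) == true) \prod_(i <- u) n i.
  by apply: eq_bigl => u; case: odd.
rewrite !E sum_ieo_seqsS; case: (odd N); rewrite /= ?mulr0n ?mulr1n //.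
by congr (_ + _ * _); apply: eq_bigl => u; case: odd.
Qed.

(** * Rational diagrams *)

(** The difference [t_1 - t_2] is the same above and below each crossing of the
twist, so every crossing adds it, or subtracts it, once more. *)
Lemma step_odd_twist k (b : bool) t :
  let t' := foldl crossing_step t (nseq k (Crossing 1 b)) in
  let d := (if b then k%:Z else - k%:Z) * (t 1%N - t 2%N) in
  [/\ t' 0%N = t 0%N, t' 1%N = t 1%N + d & t' 2%N = t 2%N + d].
Proof.
elim: k t => [|k IH] t /=; first by split=> //; case: b; lia.
have := IH (crossing_step t (Crossing 1 b)); rewrite /crossing_step /=.
case: b {IH} => /= -[-> -> ->];
  by split=> //; rewrite intS; ring.
Qed.

Lemma step_even_twist k (b : bool) t :
  let t' := foldl crossing_step t (nseq k (Crossing 0 b)) in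
  let d := (if b then - k%:Z else k%:Z) * (t 1%N - t 0%N) in
  [/\ t' 0%N = t 0%N + d, t' 1%N = t 1%N + d & t' 2%N = t 2%N].
Proof.
elim: k t => [|k IH] t /=; first by split=> //; case: b; lia.
have := IH (crossing_step t (Crossing 0 b)); rewrite /crossing_step /=.
case: b {IH} => /= -[-> -> ->];
  by split=> //; rewrite intS; ring.
Qed.

(** An odd twist changes [t_1 - t_0] by a multiple of [t_1 - t_2], and an even
twist the other way round, as in [poS] and [peS]. *)
Lemma rational_coords n N :
  let t := foldl crossing_step top_coord (word (R n N)) in
  t 1%N - t 2%N = pe n N /\ t 1%N - t 0%N = po n N.
Proof.
elim: N => [|N IH]; first by rewrite /= pe0 po0.
have -> : word (R n N.+1) = word (R n N) ++ twist n N.+1.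
  rewrite -[LHS]/(flatten [seq twist n i | i <- iota 1 N.+1]).
  by rewrite -(addn1 N) iotaD map_cat flatten_cat /= cats0 add1n addn1.
rewrite foldl_cat; move: (foldl _ _ _) IH => t /= [dE eE].
rewrite peS poS /twist /=; case: (odd N) => /=.
  have := step_even_twist `|n N.+1| (false == (0 <= n N.+1)) t => /= -[-> -> ->].
  rewrite -dE -eE; split; last by ring.
  rewrite addrAC; congr (_ + _ * _).
  by case: (lerP 0 (n N.+1)) => n0 /=; lia.
have := step_odd_twist `|n N.+1| (true == (0 <= n N.+1)) t => /= -[-> -> ->].
rewrite -dE -eE; split; first by ring.
rewrite addrAC; congr (_ + _ * _).
by case: (lerP 0 (n N.+1)) => n0 /=; lia.
Qed.

Lemma rational_wf n N : all (fun c => cleft c < 3)%N (word (R n N)).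
Proof.
rewrite /R [word _]/=; elim: (iota 1 N) => // i s IH.
rewrite /= all_cat IH andbT all_nseq /=.
by case: (odd i); rewrite orbT.
Qed.

Lemma rational_gap n N : bottom_gap (R n N) = if odd N then po n N else pe n N.
Proof.
have [dE eE] := rational_coords n N.
have coordE : level_coord (R n N) (ncross (R n N)) =
    foldl crossing_step top_coord (word (R n N)).
  by rewrite /level_coord take_oversize.
by rewrite /bottom_gap coordE -dE -eE [closing _]/=; case: (odd N).
Qed.

Theorem theorem1p1 (I : nat) (n : nat -> int) :
  (is_cse (R n (2 * I)) (bma_system (pe n (2 * I))) /\
   is_det (R n (2 * I)) `|pe n (2 * I)|) /\
  (is_cse (R n (2 * I).+1) (bma_system (po n (2 * I).+1)) /\
   is_det (R n (2 * I).+1) `|po n (2 * I).+1|).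
Proof.
have evenN : odd (2 * I) = false by rewrite mul2n odd_double.
have gap_even := rational_gap n (2 * I); rewrite evenN in gap_even.
have gap_odd := rational_gap n (2 * I).+1; rewrite /= evenN /= in gap_odd.
rewrite -gap_even -gap_odd.
by split; split; [apply: coloring_system_gap|apply: coloring_det_gap
                 |apply: coloring_system_gap|apply: coloring_det_gap];
  apply: rational_wf.
Qed.
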